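(* Let $k\ge1$ be an integer. For $\mu$-almost all $\alpha\in\mathbb{Q}_p$ there exist infinitely many $i\in\mathbb{N}$ such that $v_p(a_i)\le -k$, where $a_i$ is the $i$-th partial quotient of the Ruban continued fraction expansion of $\alpha$.
   Context: $p$ is a prime and $v_p$ is the $p$-adic valuation. $\mu$ is the Haar measure on the additive group $\mathbb{Q}_p$ normalized by $\mu(p\mathbb{Z}_p)=1$. For $\alpha=\sum_{n\ge -r}c_np^n\in\mathbb{Q}_p$ with $c_n\in\{0,\dots,p-1\}$, Ruban's floor function is $\lfloor\alpha\rfloor_p=\sum_{n=-r}^{0}c_np^n$ (equal to $0$ if $r<0$). The Ruban continued fraction expansion $[a_0,a_1,a_2,\dots]$ of $\alpha$ is obtained from $\alpha_0=\alpha$ by $a_n=\lfloor\alpha_n\rfloor_p$, $\alpha_{n+1}=\frac{1}{\alpha_n-a_n}$ for $n\ge0$, stopping if $\alpha_n=a_n$. *)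

(* Defs.v *)
From HB Require Import structures.
From mathcomp Require Import all_boot all_order all_algebra.
From mathcomp Require Import all_classical all_reals all_analysis.
From mathcomp Require Import zify ring.

Set Implicit Arguments.
Unset Strict Implicit.
Unset Printing Implicit Defensive.

Import Order.TTheory GRing.Theory Num.Theory.
Local Open Scope classical_set_scope.
Local Open Scope ring_scope.

(** The ring Z_p, as the inverse limit of the rings Z/p^n; a residue class
    modulo p^n is represented by its element of [0, p^n). *)

(* The single equation also forces 0 <= x n < p ^ n. *)
Definition coherent (p : nat) (x : nat -> int) : bool :=
  `[< forall n, x n = (x n.+1 %% p%:Z ^+ n)%Z >].

(* The type depends on the primality proof so that its integral domain structure
   can be canonical. *)
Record padic_int (p : nat) (p_pr : prime p) := PadicInt {
  residue :> nat -> int ;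
  _ : coherent p residue }.

Section PadicIntegers.
Variables (p : nat) (p_pr : prime p).
Local Notation Zp := (padic_int p_pr).
Implicit Types (x y z u v : Zp) (n : nat).

HB.instance Definition _ := [isSub for @residue p p_pr].
HB.instance Definition _ := [Choice of Zp by <:].

Let pX_gt0 n : 0 < p%:Z ^+ n.
Proof. by rewrite exprn_gt0// ltz_nat prime_gt0. Qed.

Lemma residueS x n : x n = (x n.+1 %% p%:Z ^+ n)%Z.
Proof. by case: x => f /= /asboolP. Qed.

Let modzX_le (a : int) n m : (n <= m)%N ->
  ((a %% p%:Z ^+ m)%Z = a %[mod p%:Z ^+ n])%Z.
Proof.
move=> nm; rewrite [in RHS](divz_eq a (p%:Z ^+ m)).
have -> : p%:Z ^+ m = p%:Z ^+ (m - n) * p%:Z ^+ n by rewrite -exprD subnK.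
by rewrite mulrA modzMDl.
Qed.

Lemma residue_leq x n m : (n <= m)%N -> x n = (x m %% p%:Z ^+ n)%Z.
Proof.
move=> nm; rewrite -(subnKC nm); elim: (m - n)%N => [|d IH].
  by rewrite addn0 residueS modz_mod.
by rewrite addnS IH residueS modzX_le// leq_addr.
Qed.

Lemma residue_bounds x n : 0 <= x n < p%:Z ^+ n.
Proof. by rewrite residueS modz_ge0 ?gt_eqF//= ltz_pmod. Qed.

Lemma modz_residue x n : (x n %% p%:Z ^+ n)%Z = x n.
Proof. by rewrite residueS modz_mod. Qed.

Lemma residue_inj x y : (forall n, x n = y n) -> x = y.
Proof. by move=> xy; apply/val_inj/funext. Qed.

Lemma coherent_mod (f : nat -> int) :
    (forall n, (f n = f n.+1 %[mod p%:Z ^+ n])%Z) ->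
  coherent p (fun n => (f n %% p%:Z ^+ n)%Z).
Proof. by move=> fE; apply/asboolP => n; rewrite modzX_le// fE. Qed.

Let residue_mod x n : (x n = x n.+1 %[mod p%:Z ^+ n])%Z.
Proof. by rewrite modz_residue -residueS. Qed.

Fact int_subproof (a : int) : coherent p (fun n => (a %% p%:Z ^+ n)%Z).
Proof. exact: (coherent_mod (f := fun=> a)). Qed.

Fact add_subproof x y : coherent p (fun n => ((x n + y n) %% p%:Z ^+ n)%Z).
Proof.
by apply: coherent_mod => n; rewrite -modzDm !residue_mod modzDm.
Qed.

Fact opp_subproof x : coherent p (fun n => ((- x n) %% p%:Z ^+ n)%Z).
Proof. by apply: coherent_mod => n; rewrite -modzNm residue_mod modzNm. Qed.

Fact mul_subproof x y : coherent p (fun n => ((x n * y n) %% p%:Z ^+ n)%Z).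
Proof.
by apply: coherent_mod => n; rewrite -modzMm !residue_mod modzMm.
Qed.

Definition zp_int a : Zp := PadicInt p_pr (int_subproof a).
Definition zp_add x y : Zp := PadicInt p_pr (add_subproof x y).
Definition zp_opp x : Zp := PadicInt p_pr (opp_subproof x).
Definition zp_mul x y : Zp := PadicInt p_pr (mul_subproof x y).

Fact zp_addA : associative zp_add.
Proof.
by move=> x y z; apply: residue_inj => n /=; rewrite modzDml modzDmr addrA.
Qed.

Fact zp_addC : commutative zp_add.
Proof. by move=> x y; apply: residue_inj => n /=; rewrite addrC. Qed.

Fact zp_add0 : left_id (zp_int 0) zp_add.
Proof.
by move=> x; apply: residue_inj => n /=; rewrite modzDml add0r modz_residue.
Qed.

Fact zp_addN : left_inverse (zp_int 0) zp_opp zp_add.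
Proof. by move=> x; apply: residue_inj => n /=; rewrite modzDml addNr. Qed.

HB.instance Definition _ :=
  GRing.isZmodule.Build Zp zp_addA zp_addC zp_add0 zp_addN.

Fact zp_mulA : associative zp_mul.
Proof.
by move=> x y z; apply: residue_inj => n /=; rewrite modzMml modzMmr mulrA.
Qed.

Fact zp_mulC : commutative zp_mul.
Proof. by move=> x y; apply: residue_inj => n /=; rewrite mulrC. Qed.

Fact zp_mul1 : left_id (zp_int 1) zp_mul.
Proof.
by move=> x; apply: residue_inj => n /=; rewrite modzMml mul1r modz_residue.
Qed.

Fact zp_mulDl : left_distributive zp_mul zp_add.
Proof.
by move=> x y z; apply: residue_inj => n /=; rewrite modzMml modzDm mulrDl.
Qed.

Fact zp_1neq0 : zp_int 1 != 0.
Proof.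
apply/eqP => /(congr1 (fun x : Zp => x 1%N)) /=.
by rewrite expr1 mod0z modz_small// ltz_nat prime_gt1.
Qed.

HB.instance Definition _ :=
  GRing.Zmodule_isComNzRing.Build Zp zp_mulA zp_mulC zp_mul1 zp_mulDl zp_1neq0.

Lemma residueE :
  (forall n, (0 : Zp) n = 0) * (forall n, (1 : Zp) n = (1 %% p%:Z ^+ n)%Z) *
  (forall x y n, (x + y) n = ((x n + y n) %% p%:Z ^+ n)%Z) *
  (forall x n, (- x) n = ((- x n) %% p%:Z ^+ n)%Z) *
  (forall x y n, (x * y) n = ((x n * y n) %% p%:Z ^+ n)%Z).
Proof. by do !split=> //; move=> n; rewrite /= mod0z. Qed.

(* Inverses are obtained by choice, with the convention x^-1 = x for non-units. *)
Let unit_ex x := exists y, y * x = 1.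
Let zp_unit : pred Zp := fun x => `[< unit_ex x >].
Let zp_inv x : Zp := if pselect (unit_ex x) is left h then projT1 (cid h) else x.

Fact zp_mulV : {in zp_unit, left_inverse 1 zp_inv *%R}.
Proof.
by move=> x /asboolP xu; rewrite /zp_inv; case: pselect => // h; case: cid.
Qed.

Fact zp_unitP x y : y * x = 1 -> zp_unit x.
Proof. by move=> yx; apply/asboolP; exists y. Qed.

Fact zp_inv_out : {in [predC zp_unit], zp_inv =1 id}.
Proof. by move=> x /asboolP xu; rewrite /zp_inv; case: pselect. Qed.

HB.instance Definition _ :=
  GRing.ComNzRing_hasMulInverse.Build Zp zp_mulV zp_unitP zp_inv_out.

Lemma residue_neq0 x : x != 0 -> exists n, x n.+1 != 0.
Proof.
move=> x0; apply/not_existsP => xn0; move/eqP: x0; apply; apply: residue_inj => n.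
by rewrite residueE residueS; have /negP/negPn/eqP-> := xn0 n; rewrite mod0z.
Qed.

Lemma residue_nat k n : (k%:R : Zp) n = (k%:Z %% p%:Z ^+ n)%Z.
Proof.
elim: k => [|k IH]; first by rewrite residueE mod0z.
by rewrite -natr1 residueE IH residueE modzDm addrC intS.
Qed.

Let residue_pXM n x m : (p%:R ^+ n * x) m = ((p%:Z ^+ n * x m) %% p%:Z ^+ m)%Z.
Proof.
rewrite -natrX residueE residue_nat modzMml.
by have -> : (p ^ n)%N%:Z = p%:Z ^+ n by rewrite -!natz natrX.
Qed.

Lemma zp_dvdP n x : reflect (exists y, x = p%:R ^+ n * y) (x n == 0).
Proof.
apply: (iffP eqP) => [xn0|[y ->]]; last by rewrite residue_pXM modzMr.
have dvd m : (p%:Z ^+ n %| x (n + m)%N)%Z.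
  elim: m => [|m IH]; first by rewrite addn0 xn0 dvdz0.
  rewrite addnS (divz_eq (x (n + m).+1) (p%:Z ^+ (n + m))) -residueS.
  by rewrite rpredD// dvdz_mull// exprD dvdz_mulr.
pose f m := (x (n + m)%N %/ p%:Z ^+ n)%Z.
have fE m : f m * p%:Z ^+ n = x (n + m)%N by rewrite divzK.
have pn0 : p%:Z ^+ n != 0 by rewrite gt_eqF.
have cf m : (f m = f m.+1 %[mod p%:Z ^+ m])%Z.
  have := divz_eq (x (n + m).+1) (p%:Z ^+ (n + m)).
  rewrite -residueS -addnS -!fE exprD (mulrC (p%:Z ^+ n)) mulrA -mulrDl.
  by move=> /(mulIf pn0) ->; rewrite modzMDl.
exists (PadicInt p_pr (coherent_mod cf)); apply: residue_inj => m.
by rewrite residue_pXM /= modzMmr mulrC fE -residue_leq// leq_addl.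
Qed.

Lemma zp_unitE x : (x \is a GRing.unit) = (x 1%N != 0).
Proof.
have p1 : (1 < p)%N := prime_gt1 p_pr.
apply/idP/idP => [xu|x1].
  apply/eqP => x10; have := congr1 (fun y : Zp => y 1%N) (mulrV xu).
  by rewrite /= x10 mul0r mod0z expr1 modz_small// ltz_nat.
have cop n : coprimez (x n) (p%:Z ^+ n).
  case: n => [|n]; first by rewrite expr0 coprimezE coprimen1.
  rewrite coprimez_pexpr// coprimez_sym coprimezE prime_coprime//.
  apply: contraNN x1 => px; rewrite (@residue_leq _ 1 n.+1)// expr1.
  by apply/eqP/dvdz_mod0P; rewrite dvdzE.
have [f fP] : {f : nat -> int & forall n,
    (f n * x n = 1 %[mod p%:Z ^+ n])%Z}.
  apply: (@choice nat int (fun n c => (c * x n = 1 %[mod p%:Z ^+ n])%Z)) => n.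
  have [[u v] /= uv] := coprimezP _ _ (cop n).
  by exists u; rewrite -uv addrC modzMDl.
have cf n : (f n = f n.+1 %[mod p%:Z ^+ n])%Z.
  have E : (f n.+1 * x n = 1 %[mod p%:Z ^+ n])%Z.
    by rewrite residueS modzMmr -(modzX_le _ (leqnSn n)) fP modzX_le.
  rewrite -[f n in LHS]mulr1 -modzMmr -E modzMmr mulrCA -modzMmr fP modzMmr.
  by rewrite mulr1.
apply/unitrP; exists (PadicInt p_pr (coherent_mod cf)).
suff E : PadicInt p_pr (coherent_mod cf) * x = 1 by split=> //; rewrite mulrC.
by apply: residue_inj => n; rewrite residueE /= modzMml fP.
Qed.

(* The valuation of a nonzero x is the largest n such that p^n divides x; the
   value at 0 is irrelevant. *)
Definition zp_val x : nat :=
  if pselect (exists n, x n.+1 != 0) is left h then ex_minn h else 0.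

Lemma zp_valP x : x != 0 ->
  exists2 u, u \is a GRing.unit & x = p%:R ^+ zp_val x * u.
Proof.
move=> x0; rewrite /zp_val; case: pselect => [h|/(_ (residue_neq0 x0))//].
case: ex_minnP => n xSn nmin.
have /zp_dvdP[u xE] : x n == 0.
  case: n xSn nmin => [|n] _ nmin; first by rewrite residueS expr0 modz1.
  by apply/negPn/negP => /nmin; rewrite ltnn.
exists u => //; rewrite zp_unitE; apply: contra xSn => /zp_dvdP[v vE].
by apply/zp_dvdP; exists v; rewrite xE vE expr1 mulrA exprSr.
Qed.

Let pX_unit n m u v : u \is a GRing.unit -> v \is a GRing.unit ->
  p%:R ^+ n * u = p%:R ^+ m * v -> (n <= m)%N.
Proof.
move=> uu vu E; rewrite leqNgt; apply/negP => mn.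
have : (p%:R ^+ m * 1 : Zp) m.+1 == 0.
  apply/zp_dvdP; exists (p%:R ^+ (n - m.+1) * u * v^-1).
  by rewrite mulrA mulrA -exprD subnKC// E -mulrA divrr.
rewrite mulr1 -natrX residue_nat -(natz (p ^ m)) natrX natz exprSr.
rewrite modz_small ?gt_eqF// ltW//= ltr_pMr// ltz_nat prime_gt1//.
Qed.

Lemma zp_valE n u : u \is a GRing.unit ->
  p%:R ^+ n * u != 0 /\ zp_val (p%:R ^+ n * u) = n.
Proof.
move=> uu.
have x0 : p%:R ^+ n * u != 0.
  apply/eqP => E; have : p%:R ^+ n * u = p%:R ^+ n.+1 * u.
    by rewrite exprS -mulrA E mulr0.
  move=> /esym/(pX_unit uu uu); by rewrite ltnn.
split=> //; have [v vu E] := zp_valP x0.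
by apply/eqP; rewrite eqn_leq (pX_unit vu uu (esym E)) (pX_unit uu vu E).
Qed.

Let zp_valM_subproof x y : x != 0 -> y != 0 ->
  x * y != 0 /\ zp_val (x * y) = (zp_val x + zp_val y)%N.
Proof.
move=> /zp_valP[u uu xE] /zp_valP[v vu yE].
by rewrite {1 2}xE {1 2}yE mulrACA -exprD; apply: zp_valE; rewrite unitrM uu.
Qed.

Fact zp_idomain x y : x * y = 0 -> (x == 0) || (y == 0).
Proof.
move=> xy0; apply/norP => -[x0 y0].
by have [/eqP] := zp_valM_subproof x0 y0.
Qed.

HB.instance Definition _ := GRing.ComUnitRing_isIntegral.Build Zp zp_idomain.

Lemma zp_valM x y : x != 0 -> y != 0 ->
  zp_val (x * y) = (zp_val x + zp_val y)%N.
Proof. by move=> x0 y0; have [] := zp_valM_subproof x0 y0. Qed.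

(* The i-th digit c_i of x = \sum_i c_i p^i. *)
Definition zp_digit x (i : nat) : nat := `|(x i.+1 %/ p%:Z ^+ i)%Z|%N.

Lemma zp_digit_lt x i : (zp_digit x i < p)%N.
Proof.
rewrite -ltz_nat gez0_abs ?divz_ge0//; last by case/andP: (residue_bounds x i.+1).
by rewrite ltz_divLR// -exprS; case/andP: (residue_bounds x i.+1).
Qed.

Lemma zp_digit_sum x n :
  exists y, x = \sum_(i < n) (zp_digit x i)%:R * p%:R ^+ i + p%:R ^+ n * y.
Proof.
suff /zp_dvdP[y yE] : (x - \sum_(i < n) (zp_digit x i)%:R * p%:R ^+ i) n == 0.
  by exists y; rewrite -yE addrC subrK.
have sumE : \sum_(i < n) (zp_digit x i)%:R * p%:R ^+ i = `|x n|%N%:R :> Zp.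
  elim: n => [|n IH]; first by rewrite big_ord0 residueS expr0 modz1.
  rewrite big_ord_recr /= IH -natrX -natrM -natrD; congr (_%:R).
  apply/eqP; rewrite -eqz_nat PoszD PoszM !gez0_abs ?divz_ge0//;
    do ?by case/andP: (residue_bounds x n) + case/andP: (residue_bounds x n.+1).
  rewrite -(natz (p ^ n)) natrX natz [x n]residueS addrC.
  by rewrite -divz_eq.
rewrite sumE residueE residueE residue_nat gez0_abs.
  by rewrite modzDmr modz_residue subrr mod0z.
by case/andP: (residue_bounds x n).
Qed.

Lemma zp_val_ge x n : x != 0 -> (n <= zp_val x)%N = (x n == 0).
Proof.
move=> x0; have [u uu xE] := zp_valP x0; apply/idP/zp_dvdP => [nx|[y yE]].
  by exists (p%:R ^+ (zp_val x - n) * u); rewrite mulrA -exprD subnKC.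
have y0 : y != 0 by apply: contraNneq x0 => y0; rewrite yE y0 mulr0.
have [w wu wE] := zp_valP y0.
apply: leq_trans (leq_addr (zp_val y) n) _.
by apply: (pX_unit wu uu); rewrite exprD -mulrA -wE -yE.
Qed.

Lemma zp_valD x y : x != 0 -> y != 0 -> x + y != 0 ->
  (minn (zp_val x) (zp_val y) <= zp_val (x + y)%R)%N.
Proof.
move=> x0 y0 xy0; rewrite zp_val_ge// residueE.
have /eqP-> : x (minn (zp_val x) (zp_val y)) == 0 by rewrite -zp_val_ge// geq_minl.
have /eqP-> : y (minn (zp_val x) (zp_val y)) == 0 by rewrite -zp_val_ge// geq_minr.
by rewrite addr0 mod0z.
Qed.

End PadicIntegers.

Lemma frac_reprE (R : idomainType) (x : {fraction R}) :
  x = FracField.tofrac (frac (repr x)).1 / FracField.tofrac (frac (repr x)).2.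
Proof.
set q := repr _; have q2 := denom_ratioP q.
apply: (canRL (mulfK _)); first by rewrite tofrac_eq0.
rewrite -{1}[x]reprK -/q /FracField.tofrac; unlock.
rewrite -[LHS]FracField.pi_mul; apply/eqmodP; rewrite /= FracField.equivfE.
by rewrite /FracField.mulf !numden_Ratio ?mulr1 ?oner_neq0// mulrC.
Qed.
(** The field Q_p, as the field of fractions of Z_p. *)
Definition padic (p : nat) (p_pr : prime p) : Type := {fraction padic_int p_pr}.

Section PadicNumbers.
Variables (p : nat) (p_pr : prime p).
Local Notation Zp := (padic_int p_pr).
Local Notation Qp := (padic p_pr).
Implicit Types (x y z : Qp) (a b u : Zp).

HB.instance Definition _ := GRing.Field.on Qp.
HB.instance Definition _ := isPointed.Build Qp 0.

Definition of_Zp : Zp -> Qp := @FracField.tofrac Zp.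
Local Notation "a %:F" := (of_Zp a).

HB.instance Definition _ :=
  GRing.isZmodMorphism.Build Zp Qp of_Zp (@tofrac_is_zmod_morphism Zp).
HB.instance Definition _ :=
  GRing.isMonoidMorphism.Build Zp Qp of_Zp (@tofrac_is_monoid_morphism Zp).

Lemma of_Zp_inj : injective of_Zp.
Proof. by move=> a b /eqP; rewrite /of_Zp tofrac_eq => /eqP. Qed.

Let of_Zp_neq0 a : (a%:F != 0) = (a != 0).
Proof. by rewrite -(rmorph0 of_Zp) (inj_eq of_Zp_inj). Qed.

Definition numer x : Zp := (frac (repr (x : {fraction Zp}))).1.
Definition denom x : Zp := (frac (repr (x : {fraction Zp}))).2.

Lemma denom_neq0 x : denom x != 0.
Proof. exact: denom_ratioP. Qed.

Lemma numer_denomE x : x = (numer x)%:F / (denom x)%:F.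
Proof. exact: frac_reprE. Qed.

(* v_p, with v_p(0) = +oo. *)
Definition vp x : \bar int :=
  if x == 0 then +oo%E
  else ((zp_val (numer x))%:Z - (zp_val (denom x))%:Z)%:E.

Lemma padic_ex_frac x : exists a b, b != 0 /\ x = a%:F / b%:F.
Proof.
by exists (numer x), (denom x); split; [exact: denom_neq0 | exact: numer_denomE].
Qed.

Lemma vp0 : vp 0 = +oo%E.
Proof. by rewrite /vp eqxx. Qed.

Lemma vp_frac a b : a != 0 -> b != 0 ->
  vp (a%:F / b%:F : Qp) = ((zp_val a)%:Z - (zp_val b)%:Z)%:E.
Proof.
move=> a0 b0; have x0 : a%:F / b%:F != 0 :> Qp.
  by rewrite mulf_neq0 ?invr_eq0 ?of_Zp_neq0.
rewrite /vp (negPf x0); have := numer_denomE (a%:F / b%:F).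
set n := numer _; set d := denom _; have d0 : d != 0 := denom_neq0 _ => nd.
have n0 : n != 0 by apply: contraNneq x0 => n0; rewrite nd n0 rmorph0 mul0r.
move/eqP: nd; rewrite eqr_div ?of_Zp_neq0// -!rmorphM (inj_eq of_Zp_inj) => /eqP.
move=> /(congr1 (@zp_val _ _)); rewrite !zp_valM// => nd; congr (_%:E).
by apply/eqP; rewrite subr_eq addrAC eq_sym subr_eq -!PoszD nd.
Qed.

Lemma vpM x y : vp (x * y) = (vp x + vp y)%E.
Proof.
have [->|x0] := eqVneq x 0; first by rewrite mul0r vp0 /vp; case: ifP.
have [->|y0] := eqVneq y 0.
  by rewrite mulr0 vp0 /vp; case: ifP.
have [a [b [b0 xE]]] := padic_ex_frac x; have [c [d [d0 yE]]] := padic_ex_frac y.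
have a0 : a != 0 by apply: contraNneq x0 => a0; rewrite xE a0 rmorph0 mul0r.
have c0 : c != 0 by apply: contraNneq y0 => c0; rewrite yE c0 rmorph0 mul0r.
rewrite xE yE mulf_div -!rmorphM !vp_frac ?mulf_neq0// !zp_valM//.
by rewrite -EFinD !PoszD opprD addrACA.
Qed.

Lemma vp_int a : a != 0 -> vp (a%:F : Qp) = (zp_val a)%:Z%:E.
Proof.
move=> a0; have v1 : zp_val (1 : Zp) = 0%N.
  by have [_] := zp_valE 0 (unitr1 Zp); rewrite expr0 mulr1.
have := vp_frac a0 (oner_neq0 Zp).
by rewrite rmorph1 divr1 v1 subr0.
Qed.

Lemma vp_int_ge0 a : (0%:E <= vp (a%:F : Qp))%E.
Proof.
have [->|a0] := eqVneq a 0; first by rewrite rmorph0 vp0 leey.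
by rewrite vp_int// lee_fin.
Qed.

Lemma vp_pX (n : int) : vp (p%:R ^ n) = n%:E.
Proof.
have pX m : vp (p%:R ^+ m) = m%:Z%:E.
  have [p0 pv] := zp_valE m (unitr1 Zp); rewrite mulr1 in p0 pv.
  by have := vp_int p0; rewrite pv rmorphXn rmorph_nat.
have v1 : vp 1 = 0%:E by have := pX 0%N; rewrite expr0.
case: n => m; first exact: pX.
have p0 : p%:R ^+ m.+1 != 0 :> Qp.
  by apply/eqP => p0; have := pX m.+1; rewrite p0 vp0.
have := vpM (p%:R ^+ m.+1) (p%:R ^ Negz m).
rewrite NegzE -exprnN divff// v1 pX; case: (vp _) => //= k [kE].
by congr (_%:E); apply/eqP; rewrite -addr_eq0 addrC -kE.
Qed.

Lemma vpD x y : (Order.min (vp x) (vp y) <= vp (x + y)%R)%E.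
Proof.
have [->|x0] := eqVneq x 0; first by rewrite add0r ge_min lexx orbT.
have [->|y0] := eqVneq y 0; first by rewrite addr0 ge_min lexx.
have [->|xy0] := eqVneq (x + y) 0; first by rewrite vp0 leey.
have [a [b [b0 xE]]] := padic_ex_frac x; have [c [d [d0 yE]]] := padic_ex_frac y.
have a0 : a != 0 by apply: contraNneq x0 => a0; rewrite xE a0 rmorph0 mul0r.
have c0 : c != 0 by apply: contraNneq y0 => c0; rewrite yE c0 rmorph0 mul0r.
have xyE : x + y = (a * d + c * b)%:F / (b * d)%:F.
  by rewrite rmorphD !rmorphM xE yE addf_div ?of_Zp_neq0.
have s0 : a * d + c * b != 0.
  by apply: contraNneq xy0 => s0; rewrite xyE s0 rmorph0 mul0r.
rewrite xyE xE yE !vp_frac ?mulf_neq0// -EFin_min lee_fin.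
have := zp_valD (mulf_neq0 a0 d0) (mulf_neq0 c0 b0) s0.
rewrite !zp_valM//; set s := zp_val (_ + _).
by lia.
Qed.

(* The topology whose basic neighbourhoods of x are the balls x + p^n Z_p. *)
Definition padic_open : set_system Qp := fun U =>
  forall x, U x -> exists n : int, forall y, (n%:E <= vp (y - x)%R)%E -> U y.

Fact padic_openT : padic_open setT.
Proof. by move=> x _; exists 0. Qed.

Fact padic_openI : setI_closed padic_open.
Proof.
move=> U V oU oV x [/oU[n nU] /oV[m mV]]; exists (Order.max n m) => y.
move=> nmy; split; [apply: nU | apply: mV]; apply: le_trans nmy;
  by rewrite lee_fin le_max lexx ?orbT.
Qed.

Fact padic_open_bigU (I : Type) (f : I -> set Qp) :
  (forall i, padic_open (f i)) -> padic_open (\bigcup_i f i).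
Proof.
move=> fo x [i _ fx]; have [n nf] := fo i x fx.
by exists n => y /nf fy; exists i.
Qed.

HB.instance Definition _ :=
  isOpenTopological.Build Qp padic_openT padic_openI padic_open_bigU.

(* The exponent r = - v_p(x) in x = \sum_(n >= -r) c_n p^n; see digit_sum. *)
Definition pole_order x : int := if vp x is n%:E then - n else 0.

(* The digit c_n: with r the pole order, x p^r lies in Z_p (see pole_orderP),
   and c_n is its digit of index n + r. *)
Definition digit x (n : int) : nat :=
  if (n + pole_order x)%R is Posz i then
    zp_digit (xget 0 [set a : Zp | a%:F = (x * p%:R ^ pole_order x)%R]) i
  else 0.

Let frac_aux (F : fieldType) (t a b : F) (m n : nat) : t != 0 -> b != 0 ->
  a / b = (t ^+ m * a) / (t ^+ n * b) * t ^ (n%:Z - m%:Z).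
Proof.
move=> t0 b0; rewrite expfzDr// -exprnN -exprnP; field.
by rewrite b0 !expf_neq0.
Qed.

Lemma pole_orderP x : exists a : Zp, a%:F = x * p%:R ^ pole_order x.
Proof.
have [->|x0] := eqVneq x 0; first by exists 0; rewrite rmorph0 mul0r.
have [a [b [b0 xE]]] := padic_ex_frac x.
have a0 : a != 0 by apply: contraNneq x0 => a0; rewrite xE a0 rmorph0 mul0r.
have [u uu aE] := zp_valP a0; have [w wu bE] := zp_valP b0.
have p0 : (p%:R : Qp) != 0.
  by apply/eqP => p0; have := vp_pX 1; rewrite expr1z p0 vp0.
have w0 : w%:F != 0 :> Qp.
  by rewrite of_Zp_neq0; apply: contraTneq wu => ->; rewrite unitr0.
exists (u / w); rewrite /pole_order xE vp_frac//.
rewrite {1}aE {1}bE opprB !rmorphM rmorphV// !rmorphXn !rmorph_nat /=.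
exact: (@frac_aux Qp _ _ _ _ _ p0 w0).
Qed.

Lemma digit_lt x n : (digit x n < p)%N.
Proof.
by rewrite /digit; case: (_ + _)%R => i; [exact: zp_digit_lt | exact: prime_gt0].
Qed.

Lemma digit_eq0 x n : n < - pole_order x -> digit x n = 0%N.
Proof.
by rewrite /digit -subr_lt0 opprK; case: (_ + _)%R.
Qed.

Lemma digit_sum x :
  \sum_(i < N) (digit x (i%:Z - pole_order x))%:R *
    p%:R ^ (i%:Z - pole_order x) @[N --> \oo] --> x.
Proof.
set r := pole_order x.
have p0 : (p%:R : Qp) != 0.
  by apply/eqP => p0; have := vp_pX 1; rewrite expr1z p0 vp0.
pose a := xget 0 [set a : Zp | a%:F = x * p%:R ^ r].
have aE : a%:F = x * p%:R ^ r by exact: (xgetPex 0 (pole_orderP x)).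
have dE (i : nat) : digit x (i%:Z - r) = zp_digit a i by rewrite /digit -/r subrK.
have partial N : exists b : Zp, \sum_(i < N) (digit x (i%:Z - r))%:R *
    p%:R ^ (i%:Z - r) - x = p%:R ^ (N%:Z - r) * b%:F.
  have [b bE] := zp_digit_sum a N; exists (- b).
  have xE : x = a%:F * p%:R ^ (- r).
    by rewrite aE -mulrA -expfzDr// subrr expr0z mulr1.
  rewrite (eq_bigr (fun i : 'I_N =>
      ((zp_digit a i)%:R * p%:R ^+ i)%:F * p%:R ^ (- r))); last first.
    move=> i _; rewrite dE expfzDr// -exprnP mulrA rmorphM rmorphXn.
    by rewrite !rmorph_nat.
  rewrite xE {2}bE rmorphD rmorphM rmorphXn rmorph_nat rmorph_sum /=.
  rewrite mulrDl mulr_suml opprD addrA subrr add0r expfzDr// rmorphN -exprnP.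
  by rewrite mulrN mulrAC.
move=> U; rewrite nbhsE => -[V [oV Vx] VU].
have [n nV] := oV x Vx.
exists `|(n + r)%R|%N => //= N nN; apply/VU/nV.
have [b ->] := partial N; rewrite vpM vp_pX.
have nNr : n <= N%:Z - r by rewrite lerBrDr (le_trans (ler_norm _))// -abszE.
by rewrite -[n%:E]adde0 leeD ?vp_int_ge0 ?lee_fin.
Qed.

(* The sum of the c_n p^n for -r <= n <= 0, indexed by i = -n. *)
Definition ruban_floor x : Qp :=
  if pole_order x is Posz r then \sum_(i < r.+1) (digit x (- i%:Z))%:R * p%:R ^- i
  else 0.

(* alpha_n, or None once the expansion has stopped. *)
Fixpoint complete_quotient x (n : nat) : option Qp :=
  if n is m.+1 then
    if complete_quotient x m is Some y then
      if y == ruban_floor y then None else Some (y - ruban_floor y)^-1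
    else None
  else Some x.

(* a_n; it exists as long as alpha_n does, so the last one is included. *)
Definition partial_quotient x (n : nat) : option Qp :=
  omap ruban_floor (complete_quotient x n).

Definition padic_borel := g_sigma_algebraType (@open Qp).

HB.instance Definition _ := Measurable.on padic_borel.

Definition pZp : set padic_borel := [set p%:R * of_Zp a | a in [set: Zp]].

(* Regularity is omitted: it is automatic for a Borel measure that is finite on
   compact sets, since Q_p is locally compact and second countable. *)
Definition haar_measure (R : realType)
    (mu : {measure set padic_borel -> \bar R}) : Prop :=
  [/\ forall x (A : set padic_borel), measurable A ->
        mu [set (x + y : Qp) | y in A] = mu A,
      forall K : set Qp, compact K -> (mu K < +oo)%E
    & (0 < mu [set: padic_borel])%E ].

End PadicNumbers.

Arguments pZp {p} p_pr.

(* Main.v *)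
Require Import Defs.
From mathcomp Require Import all_boot all_order all_algebra.
From mathcomp Require Import all_classical all_reals all_analysis.
From mathcomp Require Import zify ring.

(** On pZ_p, the map z |-> 1/z - floor(1/z) shifts the Ruban expansion.  Its
    inverse branch w |-> 1/(a + w), where v_p(a) = -r, multiplies distances by
    p^(-2r), and exactly (p-1)p^r floors a have v_p(a) = -r.  Hence any cover by
    balls of the set of z whose expansion is infinite with all its quotients of
    valuation > -k is pulled back, through the finitely many branches with
    1 <= r < k, to a cover of the same set whose total measure is multiplied by
    \sum_(1 <= r < k) (p-1)p^r p^(-2r) = 1 - p^(-(k-1)) < 1; so this set is null.
    An exceptional alpha has a tail in this set, or a tail equal to 0; since all
    floors are of the form m/p^r, the exceptional set is a countable union of
    Lipschitz images of null sets.  Working with finite covers makes no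
    measurability or invariance statement about the shift necessary. *)

Set Implicit Arguments.
Unset Strict Implicit.
Unset Printing Implicit Defensive.

Import Order.TTheory GRing.Theory Num.Theory.
Local Open Scope classical_set_scope.
Local Open Scope ring_scope.

(** * Valuation inequalities and divisibility in the p-adic numbers *)

Section Valuation.
Variables (p : nat) (p_pr : prime p).
Local Notation Zp := (padic_int p_pr).
Local Notation Qp := (padic p_pr).
Implicit Types (x y z : Qp) (n m : int).

(** Membership in the fractional ideal p^n Z_p; 0 belongs to all of them. *)
Definition vge n x : bool := (n%:E <= vp x)%E.

Lemma padic_p_neq0 : (p%:R : Qp) != 0.
Proof. by apply/eqP => p0; have := vp_pX p_pr 1; rewrite expr1z p0 vp0. Qed.

Lemma vge0 n : vge n (0 : Qp).
Proof. by rewrite /vge vp0 leey. Qed.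

Lemma vge_le n m x : n <= m -> vge m x -> vge n x.
Proof. by move=> nm; apply: le_trans; rewrite lee_fin. Qed.

Lemma vgeD n x y : vge n x -> vge n y -> vge n (x + y).
Proof.
by move=> nx ny; apply: le_trans (vpD x y); rewrite le_min; apply/andP.
Qed.

Lemma vgeM n m x y : vge n x -> vge m y -> vge (n + m) (x * y).
Proof. by move=> nx my; rewrite /vge vpM EFinD leeD. Qed.

Lemma vge_int (a : Zp) : vge 0 (of_Zp a).
Proof. exact: vp_int_ge0. Qed.

Lemma vge_pX n : vge n (p%:R ^ n : Qp).
Proof. by rewrite /vge vp_pX. Qed.

Lemma vgeN n x : vge n x -> vge n (- x).
Proof.
move=> nx; rewrite -mulN1r -[n]add0r; apply: vgeM nx.
by rewrite -(rmorph1 (@of_Zp p p_pr)) -rmorphN vge_int.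
Qed.

Lemma vgeB n x y : vge n x -> vge n y -> vge n (x - y).
Proof. by move=> nx ny; apply/vgeD/vgeN. Qed.

Lemma vge_fin n x : x != 0 -> ~~ vge n x -> exists2 m : int, m < n & vp x = m%:E.
Proof.
by rewrite /vge /vp => /negPf ->; rewrite lee_fin -ltNge => h; eexists; first exact: h.
Qed.

Lemma vge1F : vge 1 (1 : Qp) = false.
Proof. by have := vp_pX p_pr 0; rewrite expr0z /vge => ->. Qed.

Lemma vgeP (n : nat) x :
  reflect (exists a : Zp, x = p%:R ^+ n * of_Zp a) (vge n x).
Proof.
apply: (iffP idP) => [nx|[a ->]]; last first.
  by rewrite -[n%:Z]addr0; apply: vgeM (vge_int a); apply: (vge_pX n).
have [->|x0] := eqVneq x 0; first by exists 0; rewrite rmorph0 mulr0.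
have [a aE] := pole_orderP x; move: nx aE.
rewrite /vge /pole_order /vp (negPf x0); set v := _ - _; rewrite lee_fin => nv aE.
(* The pole order of [x] is [- v], so [a] is x p^(-v), and the surplus p^(v-n) stays in Z_p. *)
exists (p%:R ^+ `|v - n|%N * a).
rewrite rmorphM rmorphXn rmorph_nat /= aE mulrA.
have -> : p%:R ^+ n * p%:R ^+ `|v - n| = p%:R ^ v :> Qp.
  by rewrite -exprD exprnP; congr (_ ^ _); lia.
by rewrite mulrCA -expfzDr ?padic_p_neq0// subrr expr0z mulr1.
Qed.

Lemma vge_nat (n m : nat) : vge n (m%:R : Qp) = (p ^ n %| m)%N.
Proof.
have -> : m%:R = of_Zp (m%:R : Zp) by rewrite rmorph_nat.
apply/vgeP/idP => [[a]|/dvdnP[q ->]].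
  have -> : p%:R ^+ n * of_Zp a = of_Zp (p%:R ^+ n * a).
    by rewrite rmorphM rmorphXn rmorph_nat.
  move=> /of_Zp_inj mE; have : (m%:R : Zp) n == 0 by apply/zp_dvdP; exists a.
  rewrite residue_nat; have -> : p%:Z ^+ n = (p ^ n)%N by rewrite -!natz natrX.
  by rewrite modz_nat.
by exists q%:R; rewrite natrM rmorphM natrX rmorphXn !rmorph_nat mulrC.
Qed.

End Valuation.

(** * Ruban floors as fractions m/p^r *)

Lemma exprn_ratio (F : fieldType) (t : F) (i r : nat) : t != 0 -> (i <= r)%N ->
  t ^- (r - i) = t ^+ i / t ^+ r.
Proof.
move=> t0 ir; rewrite -{2}(subnKC ir) exprD invfM mulrA divff ?mul1r//.
exact: expf_neq0.
Qed.

Lemma sub_quotient_expr (F : fieldType) (t x y m : F) (r : nat) : t != 0 ->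
  x * t ^+ r = m + t ^+ r.+1 * y -> x - m / t ^+ r = t * y.
Proof.
move=> t0 xE; have tr0 : t ^+ r != 0 by rewrite expf_neq0.
apply: (mulIf tr0); rewrite mulrBl divfK// xE addrAC subrr add0r exprS.
exact: mulrAC.
Qed.

Section Floor.
Variables (p : nat) (p_pr : prime p).
Local Notation Zp := (padic_int p_pr).
Local Notation Qp := (padic p_pr).
Implicit Types (x y z : Qp).

Lemma sum_digit_lt (d : nat -> nat) n :
  (forall i, d i < p)%N -> (\sum_(i < n) d i * p ^ i < p ^ n)%N.
Proof.
move=> dp; elim: n => [|n IH]; first by rewrite big_ord0 expn0.
rewrite big_ord_recr /= expnS -addSn (leq_trans (leq_add IH (leqnn _)))//.
by rewrite -mulSn leq_mul2r dp orbT.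
Qed.

(** Let a = x p^r in Z_p. Its first r+1 digits form the integer m, and a = m + p^(r+1) y; dividing
    by p^r leaves the remainder p y. *)
Lemma ruban_floor_pole x (r : nat) : pole_order x = r ->
  vge 1 (x - ruban_floor x) /\
  exists2 m, (m < p ^ r.+1)%N & ruban_floor x = m%:R / p%:R ^+ r.
Proof.
move=> xr; have p0 := padic_p_neq0 p_pr.
pose a := xget 0 [set a : Zp | of_Zp a = (x * p%:R ^ pole_order x)%R].
have aE : of_Zp a = x * p%:R ^+ r.
  by rewrite (xgetPex 0 (pole_orderP x) : of_Zp a = _) xr.
pose m := (\sum_(i < r.+1) zp_digit a i * p ^ i)%N.
have flE : ruban_floor x = m%:R / p%:R ^+ r.
  (* The floor is summed by decreasing powers of p and m by increasing ones, hence the reversal i ->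
     r - i. *)
  rewrite /ruban_floor xr (reindex_inj rev_ord_inj) /= natr_sum mulr_suml.
  apply: eq_bigr => i _; rewrite natrM natrX subSS.
  rewrite /digit -/a xr; have -> : - (r - i)%N%:Z + r = i by have := ltn_ord i; lia.
  rewrite -mulrA; congr (_ * _).
  by apply: exprn_ratio => //; rewrite -ltnS.
split; last by exists m => //; apply: sum_digit_lt => i; exact: zp_digit_lt.
have [y yE] := zp_digit_sum a r.+1.
apply/(vgeP 1); exists y.
rewrite flE expr1; apply: sub_quotient_expr => //.
rewrite -aE {1}yE rmorphD rmorphM rmorphXn rmorph_nat rmorph_sum /=.
congr (_ + _); rewrite natr_sum; apply: eq_bigr => i _.
by rewrite rmorphM rmorphXn !rmorph_nat natrM natrX.
Qed.

Lemma vge_floor x : vge 1 (x - ruban_floor x).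
Proof.
case E: (pole_order x) => [r|r]; first by have [] := ruban_floor_pole E.
rewrite /ruban_floor E subr0; move: E; rewrite /pole_order /vge.
by case: (vp x) => [v| |] //= vE; rewrite lee_fin; lia.
Qed.

Lemma ruban_floor_nat x : exists m r : nat, ruban_floor x = m%:R / p%:R ^+ r.
Proof.
case E: (pole_order x) => [r|r].
  by have [_ [m _ ->]] := ruban_floor_pole E; exists m, r.
by exists 0%N, 0%N; rewrite /ruban_floor E mul0r.
Qed.

(** Otherwise the floor, and with it z^-1, would lie in p^(1-k) Z_p, and 1 = z z^-1 would lie in p
    Z_p. *)
Lemma vge_inv_floor (k : nat) z : z != 0 -> vge k z ->
  (vp (ruban_floor z^-1)%R <= (- k%:Z)%:E)%E.
Proof.
move=> z0 kz; rewrite leNgt; apply/negP => fk.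
suff /(vgeM kz) : vge (1 - k%:Z) z^-1.
  by rewrite divff// addrC subrK vge1F.
rewrite -[z^-1](subrK (ruban_floor z^-1)); apply: vgeD.
  by apply: vge_le (vge_floor _); lia.
move: fk; rewrite /vge; case: vp => [v| |] //=; rewrite ?leey//.
 by rewrite lte_fin lee_fin; lia.
Qed.

(** Here r = v_p(z). The bounds on r and m leave finitely many possible floors, and coprimality
    makes their number exact enough for a total contraction below 1. *)
Lemma ruban_floor_inv z (k : nat) : z != 0 -> vge 1 z -> ~~ vge k z ->
  exists r m : nat, [/\ (0 < r < k)%N, vge r z, (m < p ^ r.+1)%N, coprime (p ^ r.+1) m &
     ruban_floor z^-1 = m%:R / p%:R ^+ r].
Proof.
move=> z0 z1 zk; have [v vk vE] := vge_fin z0 zk.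
have v1 : 1 <= v by move: z1; rewrite /vge vE.
case: v v1 vk vE => // r r0 rk vE.
have rE : pole_order z^-1 = r.
  have := vpM z z^-1; rewrite divff// vE; have := vp_pX p_pr 0; rewrite expr0z => ->.
  by rewrite /pole_order; case: vp => //= w [/eqP]; lia.
have [_ [m mp mE]] := ruban_floor_pole rE.
exists r, m; split=> //; first by lia.
  by rewrite /vge vE.
(* If p divided m, then z^-1 would lie in p^(1-r) Z_p, and again 1 in p Z_p. *)
rewrite coprime_pexpl// prime_coprime//; apply/negP => pm.
suff : vge (1 - r%:Z) z^-1.
  have zr : vge r z by rewrite /vge vE.
  by move=> /(vgeM zr); rewrite divff// addrC subrK vge1F.
rewrite -[z^-1](subrK (ruban_floor z^-1)); apply: vgeD.
  by apply: vge_le (vge_floor _); lia.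
rewrite mE; apply: vgeM; first by rewrite vge_nat expn1.
by rewrite exprnN vge_pX.
Qed.

End Floor.

(** * Finite covers by balls and their total weight *)

Section Covers.
Variables (R : realType) (p : nat) (p_pr : prime p).
Local Notation Qp := (padic p_pr).
Implicit Types (b : Qp * nat) (s : seq (Qp * nat)) (A C : set Qp).

(* The ball x + p^(n+1) Z_p, of measure p^(-n) since mu (p Z_p) = 1. *)
Definition cball b : set Qp := [set y | vge b.2.+1 (y - b.1)].

Definition cweight s : R := \sum_(b <- s) p%:R ^- b.2.

(** Covers are finite, so this bounds an outer Jordan content; [cover_null] is content zero, which
    is stable under finite but not countable unions. *)
Definition covered A (e : R) :=
  exists2 s, A `<=` [set y | exists2 b, b \in s & cball b y] & cweight s <= e.

Definition cover_null A := forall e : R, 0 < e -> covered A e.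

Lemma p_gt0R : 0 < p%:R :> R.
Proof. by rewrite ltr0n prime_gt0. Qed.

Lemma coveredS A C e : A `<=` C -> covered C e -> covered A e.
Proof. by move=> AC [s Cs se]; exists s => // y /AC/Cs. Qed.

Lemma covered_le A e e' : e <= e' -> covered A e -> covered A e'.
Proof. by move=> ee' [s As se]; exists s => //; exact: le_trans ee'. Qed.

Lemma covered_bigcup (I : eqType) (r : seq I) (F : I -> set Qp) (e : I -> R) :
  (forall i, i \in r -> covered (F i) (e i)) ->
  covered [set y | exists2 i, i \in r & F i y] (\sum_(i <- r) e i).
Proof.
elim: r => [|i r IH] Fe.
  by exists [::]; [move=> y [] | rewrite /cweight !big_nil].
have [s Fs se] := Fe i (mem_head _ _).
have [|t Ft te] := IH; first by move=> j jr; apply: Fe; rewrite inE jr orbT.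
exists (s ++ t); last by rewrite big_cons /cweight big_cat lerD.
move=> y [j]; rewrite inE => /predU1P[->|jr] Fy.
  by have [b bs by_] := Fs y Fy; exists b; rewrite ?mem_cat ?bs.
by have [|b bt by_] := Ft y; [exists j | exists b; rewrite ?mem_cat ?bt ?orbT].
Qed.

(** Since g expands distances on C by at least p^m, the points of C sent into one ball of the cover
    lie in a single ball smaller by p^m. Each ball is replaced by one ball. *)
Lemma covered_preimage A C (g : Qp -> Qp) (m : nat) (e : R) :
  (forall u, C u -> A (g u)) ->
  (forall u v (n : nat), C u -> C v -> vge n.+1 (g u - g v) -> vge (n + m).+1 (u - v)) ->
  covered A e -> covered C (p%:R ^- m * e).
Proof.
move=> CA gm [s As se].
(* The new centre is any point of C sent into [b]; if there is none, the default centre 0 only adds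
   a harmless ball. *)
exists [seq (xget 0 [set u | C u /\ cball b (g u)], (b.2 + m)%N) | b <- s].
  move=> u Cu; have [b bs bu] := As _ (CA u Cu).
  eexists; first by apply: (map_f _ bs).
  have /(xgetPex 0)[Cv bv] : exists v, [set u | C u /\ cball b (g u)] v by exists u.
  apply: gm => //=; rewrite -(subrK b.1 (g u)) -addrA; apply: vgeD => //.
  by rewrite -opprB; apply: vgeN.
apply: (@le_trans _ _ (p%:R ^- m * cweight s)).
  rewrite /cweight big_map mulr_sumr; apply: ler_sum => b _ /=.
  by rewrite exprD invfM mulrC.
by rewrite ler_wpM2l// invr_ge0 exprn_ge0// ler0n.
Qed.

Lemma cover_null_preimage A C (g : Qp -> Qp) (m : nat) :
  (forall u, C u -> A (g u)) ->
  (forall u v (n : nat), C u -> C v -> vge n.+1 (g u - g v) -> vge (n + m).+1 (u - v)) ->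
  cover_null A -> cover_null C.
Proof.
move=> CA gm A0 e e0; have p0 : (0 : R) < p%:R ^+ m by rewrite exprn_gt0 ?p_gt0R.
have /(covered_preimage CA gm) := A0 _ (mulr_gt0 p0 e0).
by rewrite mulKf ?gt_eqF.
Qed.

End Covers.

(** * Haar measure of balls, and negligibility from covers *)

Section Haar.
Variables (R : realType) (p : nat) (p_pr : prime p).
Local Notation Qp := (padic p_pr).
Variable mu : {measure set (padic_borel p_pr) -> \bar R}.
Hypotheses (mu_haar : haar_measure mu) (mu_pZp : mu (pZp p_pr) = 1%:E).
Implicit Types (b : Qp * nat) (s : seq (Qp * nat)) (A : set Qp).

Lemma open_cball b : open (cball b).
Proof.
suff : padic_open (cball b) by [].
move=> x bx; exists b.2.+1%:Z => y yx; rewrite /cball /=.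
by rewrite -(subrK x y) -addrA; apply: vgeD.
Qed.

Lemma measurable_cball b : measurable (cball b : set (padic_borel p_pr)).
Proof. by apply: sub_sigma_algebra; exact: open_cball. Qed.

Lemma pZpE : pZp p_pr = cball (0, 0%N).
Proof.
apply/seteqP; split=> y /=; rewrite /pZp /cball /= subr0.
  by move=> [a _ <-]; apply/(vgeP 1); exists a; rewrite expr1.
by move=> /(vgeP 1)[a ->]; exists a; rewrite ?expr1.
Qed.

Lemma mu_cball_center (x : Qp) (n : nat) : mu (cball (x, n)) = mu (cball (0, n)).
Proof.
have [muD _ _] := mu_haar; rewrite -(muD x _ (measurable_cball (0, n))).
congr (mu _); apply/seteqP; split=> y; rewrite /cball /=.
  by move=> yx; exists (y - x); rewrite ?subr0// addrC subrK.
by move=> [z zn <-]; move: zn; rewrite subr0 addrAC subrr add0r.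
Qed.

(** The p^n balls centred at i p, for i < p^n, are disjoint, have equal measure by translation, and
    lie in p Z_p, which has measure 1. *)
Lemma mu_cball b : (mu (cball b) <= (p%:R ^- b.2)%:E)%E.
Proof.
case: b => x n; rewrite mu_cball_center /=; set N := (p ^ n)%N.
have N0 : (0 < N)%N by rewrite expn_gt0 prime_gt0.
pose F (i : nat) : set (padic_borel p_pr) := cball ((i * p)%N%:R, n).
have mF i : measurable (F i) by exact: measurable_cball.
have FF i j (y : Qp) : F i y -> F j y -> (i < N)%N -> (j < N)%N -> (j <= i)%N -> i = j.
  rewrite /F /cball /= => yi yj iN jN ji.
  have : vge n.+1 ((i * p)%N%:R - (j * p)%N%:R : Qp).
    have -> : (i * p)%N%:R - (j * p)%N%:R = y - (j * p)%N%:R - (y - (i * p)%N%:R) :> Qp.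
      by rewrite opprB [RHS]addrC addrA subrK.
    exact: vgeB.
  (* A common point puts (i - j) p in p^(n+1) Z_p, so p^n divides i - j < p^n. *)
  rewrite -natrB ?leq_mul2r ?ji ?orbT// -mulnBl vge_nat expnSr dvdn_pmul2r ?prime_gt0//.
  move=> /dvdnP[[|q]] E; first by lia.
  by exfalso; move: E; rewrite mulSn -/N; lia.
have muF (m : nat) : (m <= N)%N ->
    mu (\big[setU/set0]_(i < m) F i) = (m%:R%:E * mu (cball (0%R, n)))%E.
  elim: m => [|m IH] mN; first by rewrite big_ord0 measure0 mul0e.
  rewrite big_ord_recr /=.
  have -> : mu (\big[setU/set0]_(i < m) F i `|` F m) =
      (mu (\big[setU/set0]_(i < m) F i) + mu (F m))%E.
    apply: measureU => //; first exact: bigsetU_measurable.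
    rewrite -subset0 => y /= []; rewrite -bigcup_mkord => -[i /= im Fiy] Fmy.
    by have := FF _ _ _ Fmy Fiy mN (ltn_trans im mN) (ltnW im); lia.
  rewrite IH 1?ltnW// -natr1 EFinD ge0_muleDl ?lee_fin ?ler0n//.
  by rewrite mul1e /F mu_cball_center.
have : (mu (\big[setU/set0]_(i < N) F i) <= 1%:E)%E.
  rewrite -mu_pZp; apply: le_measure; rewrite ?inE.
  - exact: bigsetU_measurable.
  - by rewrite pZpE; exact: measurable_cball.
  rewrite pZpE -bigcup_mkord => y [i _]; rewrite /F /cball /= subr0 => yi.
  rewrite -(subrK (i * p)%N%:R y); apply: vgeD.
    by apply: vge_le yi; lia.
  by rewrite vge_nat expn1 dvdn_mull.
rewrite muF// muleC -lee_pdivlMr ?ltr0n// mul1e /N natrX.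
by [].
Qed.

Lemma mu_cover s : exists C : set (padic_borel p_pr),
  [/\ measurable C, C = [set y | exists2 b, b \in s & cball b y] &
      (mu C <= (cweight R s)%:E)%E].
Proof.
elim: s => [|b s [C [mC CE Cs]]].
  exists set0; split=> //; last by rewrite measure0 /cweight big_nil.
  by apply/seteqP; split=> y //= [].
exists (cball b `|` C); split; first exact: measurableU (measurable_cball b) mC.
  rewrite CE; apply/seteqP; split=> y /=.
    by move=> [by_|[c cs cy]]; [exists b | exists c]; rewrite ?inE ?eqxx ?cs ?orbT.
  by move=> [c]; rewrite inE => /predU1P[->|cs] cy; [left | right; exists c].
apply: le_trans (measureU2 _ (measurable_cball b) mC) _.
by rewrite /cweight big_cons EFinD; apply: leeD => //; exact: mu_cball.
Qed.

(** Covers of weight at most 1/(n+1), one for each n, intersect in a measurable null set containing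
    A. *)
Lemma cover_null_negligible A : cover_null R A -> mu.-negligible A.
Proof.
move=> A0; have [s As] : {s : nat -> seq (Qp * nat) & forall n : nat,
    A `<=` [set y | exists2 b, b \in s n & cball b y] /\ cweight R (s n) <= n.+1%:R^-1}.
  apply: (@choice nat _ (fun n s => A `<=` [set y | exists2 b, b \in s & cball b y] /\
    cweight R s <= n.+1%:R^-1)) => n.
  by have [|s ? ?] := A0 n.+1%:R^-1; [rewrite invr_gt0 ltr0n | exists s].
have [C CP] := choice (fun n => mu_cover (s n)).
have mC n : measurable (C n) by have [] := CP n.
have mI : measurable (\bigcap_n C n) by exact: bigcapT_measurable.
exists (\bigcap_n C n); split=> //; last first.
  by move=> y Ay n _; have [_ -> _] := CP n; have [+ _] := As n; apply.
apply/eqP; rewrite -measure_le0; apply/lee_addgt0Pr => e e0; rewrite add0e.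
have [n ne] : exists n : nat, n.+1%:R^-1 < e.
  by have [N _ /(_ N (leqnn N)) NE] := near_infty_natSinv_lt (PosNum e0); exists N.
have [_ _ Cn] := CP n; have [_ sn] := As n.
apply: (@le_trans _ _ (mu (C n))); first by apply: le_measure; rewrite ?inE// => y; apply.
apply: le_trans Cn _; rewrite lee_fin; exact: le_trans sn (ltW ne).
Qed.

End Haar.

(** * The shift map, its inverse branches, and expansions with small quotients *)

Lemma subr_inv (F : fieldType) (u v a : F) : u != 0 -> v != 0 ->
  u - v = - (u * v * (u^-1 - a - (v^-1 - a))).
Proof. by move=> u0 v0; field; rewrite u0 v0. Qed.

Lemma expr_le_ex (R : realType) (c e : R) : 0 <= c < 1 -> 0 < e ->
  exists n, c ^+ n <= e.
Proof.
move=> /andP[c0 c1] e0; have c1' : `|c| < 1 by rewrite ger0_norm.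
have /cvgrPdist_lt/(_ e e0)[n _ /(_ n (leqnn n))] := cvg_expr c1'.
by rewrite sub0r normrN ger0_norm ?exprn_ge0// => /ltW; exists n.
Qed.

Section Gauss.
Variables (R : realType) (p : nat) (p_pr : prime p).
Local Notation Qp := (padic p_pr).
Implicit Types (A : set Qp) (x y z : Qp).

(** Carries the fractional part of one complete quotient to that of the next. *)
Definition gauss z : Qp := z^-1 - ruban_floor z^-1.

(** The part in p^r Z_p of the image of A under w -> 1/(a + w), written as a preimage to suit
    [covered_preimage]. *)
Definition inv_branch (a : Qp) (r : nat) A : set Qp :=
  [set u | [/\ u != 0, vge r u & A (u^-1 - a)]].

(** In u - v = - u v (1/u - 1/v), the factors u and v contribute r each. *)
Lemma vge_inv_branch a r A u v (n : nat) :
  inv_branch a r A u -> inv_branch a r A v ->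
  vge n.+1 (u^-1 - a - (v^-1 - a)) -> vge (n + 2 * r).+1 (u - v).
Proof.
move=> [u0 ur _] [v0 vr _] uvn; rewrite (subr_inv a u0 v0).
apply: vgeN; have := vgeM (vgeM ur vr) uvn.
by apply: vge_le; lia.
Qed.

Lemma covered_inv_branch a r A (e : R) :
  covered A e -> covered (inv_branch a r A) (p%:R ^- (2 * r) * e).
Proof.
apply: (@covered_preimage _ _ _ _ _ (fun u => u^-1 - a)); first by move=> u [].
by move=> u v n; exact: vge_inv_branch.
Qed.

Lemma cover_null_inv_branch a r A :
  cover_null R A -> cover_null R (inv_branch a r A).
Proof.
apply: (@cover_null_preimage _ _ _ _ _ (fun u => u^-1 - a) (2 * r)); first by move=> u [].
by move=> u v n; exact: vge_inv_branch.
Qed.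

Lemma cover_null_translate a A : cover_null R A -> cover_null R [set u | A (u - a)].
Proof.
apply: (@cover_null_preimage _ _ _ _ _ (fun u => u - a) 0) => // u v n _ _.
by rewrite addn0 opprB addrA subrK.
Qed.

Lemma cover_null0 : cover_null R [set (0 : Qp)].
Proof.
move=> e e0; have p1 := prime_gt1 p_pr.
have [|n ne] := @expr_le_ex _ (p%:R^-1 : R) e _ e0.
  by rewrite invr_ge0 ler0n/= invf_lt1 ?ltr1n ?ltr0n ?prime_gt0.
exists [:: (0, n)]; last by rewrite /cweight big_seq1 -exprVn.
by move=> y ->; exists (0, n); rewrite ?mem_seq1// /cball /= subrr vge0.
Qed.

(* A quotient floor(1/w) has valuation > -k iff v_p(w) < k. *)
Definition small_quotients (k : nat) : set Qp :=
  [set z | vge 1 z /\ forall i, iter i gauss z != 0 /\ ~~ vge k (iter i gauss z)].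

Lemma small_quotients_gauss k z : small_quotients k z -> small_quotients k (gauss z).
Proof.
move=> [z1 zk]; split; first exact: vge_floor.
by move=> i; rewrite -iterSr; exact: zk.
Qed.

(** Prime to p^(r+1) means prime to p; in this form the count is Euler's totient of p^(r+1). *)
Definition numerators (r : nat) := [seq m <- index_iota 0 (p ^ r.+1) | coprime (p ^ r.+1) m].

Lemma small_quotientsS k : small_quotients k `<=`
  [set z | exists2 r, r \in index_iota 1 k &
    exists2 m, m \in numerators r &
      inv_branch (m%:R / p%:R ^+ r) r (small_quotients k) z].
Proof.
move=> z Bz; have [z1 /(_ 0%N)[z0 zk]] := Bz.
have [r [m [r0k zr mp cop fE]]] := ruban_floor_inv z0 z1 zk.
exists r; first by rewrite mem_index_iota.
exists m; first by rewrite mem_filter cop mem_index_iota mp.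
have := small_quotients_gauss Bz; rewrite /gauss fE.
by split.
Qed.

Lemma size_numerators r : size (numerators r) = (p.-1 * p ^ r)%N.
Proof.
rewrite size_filter -sum1_count big_mkcond /= -(totient_pfactor p_pr (ltn0Sn r)).
by rewrite totient_count_coprime; apply: eq_bigr => m _; case: coprime.
Qed.

Definition decay (k : nat) : R := 1 - p%:R ^- k.-1.

(** The (p-1) p^r branches of level r contribute (p-1) p^(-r) = p^(-(r-1)) - p^(-r), which
    telescopes over 1 <= r < k. *)
Lemma sum_decay k (e : R) : (0 < k)%N ->
  \sum_(r <- index_iota 1 k) \sum_(m <- numerators r) p%:R ^- (2 * r) * e =
  decay k * e.
Proof.
case: k => // k _; have p0 : (p%:R : R) != 0 by rewrite gt_eqF ?p_gt0R.
have sum_const (c : R) r : \sum_(m <- numerators r) c = c * (p%:R - 1) * p%:R ^+ r.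
  rewrite big_const_seq count_predT size_numerators iter_addr addr0 -[LHS]mulr_natr.
  by rewrite natrM natrX -subn1 natrB ?prime_gt0// mulrA.
under eq_bigr do rewrite sum_const.
rewrite /decay /=; elim: k => [|k IH].
  by rewrite big_geq// expr0 invr1 subrr mul0r.
rewrite big_nat_recr//= IH.
rewrite mulnC exprM !exprS. field.
by rewrite p0 expf_neq0.
Qed.

Lemma covered_small_quotients k (e : R) : (0 < k)%N ->
  covered (small_quotients k) e -> covered (small_quotients k) (decay k * e).
Proof.
move=> k0 Be; apply: coveredS (@small_quotientsS k) _; rewrite -sum_decay//.
by apply: covered_bigcup => r _; apply: covered_bigcup => m _; exact: covered_inv_branch.
Qed.

Lemma cover_null_small_quotients k : (0 < k)%N -> cover_null R (small_quotients k).
Proof.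
move=> k0 e e0.
have dn n : covered (small_quotients k) (decay k ^+ n).
  elim: n => [|n IH]; last by rewrite exprS; exact: covered_small_quotients.
  (* The iteration starts from the single ball p Z_p, of weight p^0 = 1. *)
  exists [:: (0, 0%N)]; last by rewrite /cweight big_seq1 !expr0 invr1.
  by move=> y [y1 _]; exists (0, 0%N); rewrite ?mem_seq1// /cball /= subr0.
have [|n ne] := @expr_le_ex _ (decay k) e _ e0; last exact: covered_le (dn n).
have pk : (0 : R) < p%:R ^+ k.-1 by rewrite exprn_gt0 ?p_gt0R.
rewrite /decay ltrBlDr ltrDl invr_gt0 pk andbT subr_ge0 invf_le1//.
by rewrite exprn_ege1// ler1n prime_gt0.
Qed.

(** * From tails to the exceptional set *)

Lemma complete_quotientS x n y : complete_quotient x n.+1 = Some y ->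
  exists z, [/\ complete_quotient x n = Some z, z - ruban_floor z != 0 &
    y = (z - ruban_floor z)^-1].
Proof.
rewrite /=; case: complete_quotient => // z; case: ifPn => // zf [<-].
by exists z; rewrite subr_eq0.
Qed.

Variable mu : {measure set (padic_borel p_pr) -> \bar R}.
Hypotheses (mu_haar : haar_measure mu) (mu_pZp : mu (pZp p_pr) = 1%:E).

Definition tail_in n A : set Qp :=
  [set x | exists2 y, complete_quotient x n = Some y & A (y - ruban_floor y)].

(** Each step back through the expansion replaces A by its inverse branches over the countably many
    floors. These unions are taken at the level of [mu], since content zero would not survive
    them. *)
Lemma tail_in_negligible n A : cover_null R A -> mu.-negligible (tail_in n A).
Proof.
elim: n A => [|n IH] A A0.
  apply: (@negligibleS _ _ _ mu (\bigcup_m \bigcup_r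
      [set x : Qp | A (x - m%:R / p%:R ^+ r)])).
    move=> x [y [<-]]; have [m [r ->]] := ruban_floor_nat x.
    by move=> Ax; exists m => //; exists r.
  apply: negligible_bigcup => m; apply: negligible_bigcup => r.
  by apply: cover_null_negligible => //; exact: cover_null_translate.
(* Exponent 0 suffices in [inv_branch]: the branch is Lipschitz on Z_p, and no contraction is asked
   for. *)
apply: (@negligibleS _ _ _ mu (\bigcup_m \bigcup_r
    tail_in n (inv_branch (m%:R / p%:R ^+ r) 0 A))).
  move=> x [y /complete_quotientS[z [zE z0 ->]]].
  have [m [r ->]] := ruban_floor_nat (z - ruban_floor z)^-1.
  move=> Ax; exists m => //; exists r => //; exists z => //; split=> //.
  exact: vge_le (vge_floor z).
apply: negligible_bigcup => m; apply: negligible_bigcup => r.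
by apply: IH; exact: cover_null_inv_branch.
Qed.

Definition large_quotient k x : set nat :=
  [set i | exists2 a, partial_quotient x i = Some a & (vp a <= (- k%:Z)%:E)%E].

(** A terminating expansion ends with fractional part 0; in an infinite one, all quotients beyond
    the last large index have valuation > -k. *)
Lemma finite_large_quotient k x : finite_set (large_quotient k x) ->
  exists n, tail_in n (small_quotients k) x \/ tail_in n [set 0] x.
Proof.
move=> /finite_seqP[s sE].
have [[n nN]|cqS] := pselect (exists n, complete_quotient x n = None).
  (* Descend to the last complete quotient that exists; it equals its own floor. *)
  elim: n nN => // n IH /=; case E: complete_quotient => [y|] => [|_]; last exact: IH.
  case: ifPn => // /eqP yE _; exists n; right; exists y => //.
  by rewrite -yE subrr.
have [q qE] : {q : nat -> Qp & forall n, complete_quotient x n = Some (q n)}.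
  apply: (@choice nat Qp (fun n y => complete_quotient x n = Some y)) => n.
  by case E: complete_quotient => [y|]; [exists y | case: cqS; exists n].
pose z n := q n - ruban_floor (q n).
have zP n : z n != 0 /\ q n.+1 = (z n)^-1.
  have [y [yE y0 yS]] := complete_quotientS (qE n.+1).
  by move: (qE n); rewrite yE => -[yq]; rewrite yS /z -yq.
have zS n : z n.+1 = gauss (z n) by rewrite {1}/z (zP n).2.
pose N := \max_(i <- s) i.
exists N; left; exists (q N) => //; split; first exact: vge_floor.
move=> i; have -> : iter i gauss (z N) = z (N + i)%N.
  by elim: i => [|i IH]; rewrite ?addn0// iterS IH addnS zS.
have [z0 zE] := zP (N + i)%N; split=> //; apply/negP => zk.
(* If z_(N+i) lay in p^k Z_p, the quotient it produces, of index N+i+1, would be large, beyond the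
   maximum N. *)
suff : [set` s] (N + i).+1.
  by move=> /= Ns; have := leq_bigmax_seq (P := xpredT) (F := id) _ Ns isT; rewrite -/N; lia.
rewrite -sE; exists (ruban_floor (z (N + i)%N)^-1); last exact: vge_inv_floor.
by rewrite /partial_quotient qE zE.
Qed.

End Gauss.

Theorem corollary6 (R : realType) (p : nat) (p_pr : prime p)
    (mu : {measure set (padic_borel p_pr) -> \bar R})
    (mu_haar : haar_measure mu) (mu_pZp : mu (pZp p_pr) = 1%:E)
    (k : nat) (k_ge1 : (1 <= k)%N) :
  {ae mu, forall alpha : padic_borel p_pr,
    infinite_set [set i : nat | exists2 a : padic p_pr,
      partial_quotient alpha i = Some a & (vp a <= (- k%:Z)%:E)%E]}.
Proof.
have tail0 := @tail_in_negligible R p p_pr mu mu_haar mu_pZp.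
apply: (@negligibleS _ _ _ mu (\bigcup_n
    (tail_in n (small_quotients k) `|` tail_in n [set 0]))).
  move=> x /= /contrapT /finite_large_quotient[n nx]; by exists n.
apply: negligible_bigcup => n; apply: negligibleU; apply: tail0.
  exact: cover_null_small_quotients.
exact: cover_null0.
Qed.
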